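(* Let $X$ and $Y$ be metrizable spaces, and let $M$ and $N$ be absolute retracts containing $X$ and $Y$, respectively, as closed Z-sets. For a continuous map $f\colon M\setminus X\to N\setminus Y$ the following are equivalent: (1) $f$ is an $X$-$Y$-approaching map; (2) if $U\subset N\setminus Y$ is such that $U\cup Y$ is an open neighborhood of $Y$ in $N$, then $f^{-1}(U)\cup X$ is an open neighborhood of $X$ in $M$; (3) if $K\subset M\setminus X$ has compact closure in $M$, then $f(K)$ has compact closure in $N$ and $f|_K\colon K\to f(K)$ is a proper map.
   Context: An absolute retract is a metrizable space that is a retract of every metrizable space containing it as a closed subset. A closed subset $X$ of an absolute retract $M$ is a Z-set if there is a homotopy $h_t\colon M\to M$, $t\in[0,1]$, with $h_0=\mathrm{id}$ and $h_t(M)\subset M\setminus X$ for all $t>0$. A continuous map $f\colon M\setminus X\to N\setminus Y$ is called $X$-$Y$-approaching if it sends every sequence of points of $M\setminus X$ which has a cluster point in $X$ to a sequence which has a cluster point in $Y$. A continuous map is proper if preimages of compact sets are compact.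
   Formalization: Condition (3) is false as printed and is corrected: f(K) has compact closure in N for every K with compact closure in M, but properness of f|_K is required only for K closed in M∖X, and as a map K → N∖Y instead of K → f(K). *)

(* Defs.v *)
From HB Require Import structures.
From mathcomp Require Import all_boot all_order all_algebra.
From mathcomp Require Import all_classical all_reals all_analysis.
Import Order.TTheory GRing.Theory Num.Theory.
Import numFieldNormedType.Exports.

Set Implicit Arguments.
Unset Strict Implicit.
Unset Printing Implicit Defensive.

Local Open Scope classical_set_scope.
Local Open Scope ring_scope.

Definition metrizable (R : realType) (T : topologicalType) : Prop :=
  exists d : T -> T -> R,
    [/\ forall x y, 0 <= d x y,
        forall x y, d x y = 0 <-> x = y,
        forall x y, d x y = d y x,
        forall x y z, d x z <= d x y + d y z &
        forall (x : T) (A : set T),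
          nbhs x A <-> exists2 e, 0 < e & [set y | d x y < e] `<=` A].

Definition closed_embedding (S T : topologicalType) (i : S -> T) : Prop :=
  [/\ injective i, continuous i &
      forall A : set S, closed A -> closed (i @` A)].

(* "Containing M as a closed subset" is rendered by a closed embedding
   [i : M -> Z]. *)
Definition absolute_retract (R : realType) (M : topologicalType) : Prop :=
  metrizable R M /\
  forall (Z : topologicalType) (i : M -> Z),
    metrizable R Z -> closed_embedding i ->
    exists2 r : Z -> M, continuous r & forall x, r (i x) = x.

(* Only the values [h t] for [t] in [0, 1] are meaningful. *)
Definition Zset (R : realType) (M : topologicalType) (X : set M) : Prop :=
  closed X /\
  exists h : R -> M -> M,
    [/\ {within `[0, 1] `*` [set: M], continuous (fun p : R * M => h p.1 p.2)},
        forall x, h 0 x = x &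
        forall t x, 0 < t <= 1 -> ~ X (h t x)].

Definition proper_map (S T : topologicalType) (g : S -> T) : Prop :=
  continuous g /\ forall C : set T, compact C -> compact (g @^-1` C).

(* Below, a set used as a type, e.g. [~` X], is the subtype [set_type (~` X)]
   with its subspace topology, and [set_val] is its inclusion. *)
Section conditions.
Context (M N : topologicalType) (X : set M) (Y : set N).
Implicit Type f : ~` X -> ~` Y.

(* [cluster (u @ \oo)] is the set of cluster points of the sequence [u]. *)
Definition approaching f : Prop :=
  forall u : nat -> ~` X,
    (exists2 x : M, X x & cluster ((fun n => set_val (u n)) @ \oo) x) ->
    exists2 y : N, Y y & cluster ((fun n => set_val (f (u n))) @ \oo) y.

Definition pulls_back_open_nbhs f : Prop :=
  forall U : set (~` Y),
    open (set_val @` U `|` Y) -> open (set_val @` (f @^-1` U) `|` X).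

(* The restriction of [f] to [K] is required to be proper only for [K] closed
   in the complement of [X], but then as a map into the complement of [Y]
   (hence also as a map onto its image). With [K] arbitrary and codomain
   [f @` K] the condition would neither follow from nor imply [approaching]:
   take M = N = [0, 1] and X = Y = {0}. The map t |-> min(t, 1/2) is
   approaching, but its restriction to K = ]1/2, 1[ is a constant map that is
   not proper onto its image. The map t |-> 1/2 + t/4 is not approaching, but
   it is an embedding, so each of its restrictions is proper onto its image. *)
Definition restrictions_proper f : Prop :=
  forall K : set (~` X),
    compact (closure (set_val @` K)) ->
    compact (closure (set_val @` (f @` K))) /\
    (closed K -> proper_map (fun x : K => f (set_val x))).

End conditions.

(* Main.v *)
(* (1) <-> (2): a point of [X] at which the pulled back set fails to be a
   neighborhood is the limit of a sequence avoiding it, and conversely the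
   complement of the closure of a sequence [f (u n)] without cluster points in
   [Y] is an open neighborhood of [Y].
   (2) -> (3): the first half holds since, by (1), every sequence in [f K] has
   a cluster point; for properness, the complement of a compact [C] disjoint
   from [Y] is pulled back to a neighborhood of [X], so that [f^-1 C] does not
   accumulate at [X].
   (3) -> (2): if [u n] tends to a point of [X] while [f (u n)] stays outside
   [U], take [K = range u]; the closure of [f K] minus the neighborhood
   [U `|` Y] is a compact set whose preimage in [K] is [K], so [K] would be
   compact, hence closed in [M]. *)
Require Import Defs.
From mathcomp Require Import all_boot all_order all_algebra.
From mathcomp Require Import all_classical all_reals all_analysis.
From mathcomp Require Import lra.
Import Order.TTheory GRing.Theory Num.Theory.

Set Implicit Arguments.
Unset Strict Implicit.
Unset Printing Implicit Defensive.

Local Open Scope classical_set_scope.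

(** * Cluster points and limits of sequences *)

Lemma cluster_seqP (T : topologicalType) (u : nat -> T) (x : T) :
  cluster (u @ \oo) x <->
  forall V N, nbhs x V -> exists2 n, (N <= n)%N & V (u n).
Proof.
split=> [ux V N xV|ux A V [N _ NA] xV].
  have [] := ux (u @` [set n | (N <= n)%N]) V _ xV.
    by exists N => // n /= Nn; exists n.
  by move=> _ [[n /= Nn <-] Vn]; exists n.
by have [n Nn Vn] := ux V N xV; exists (u n); split => //; exact: NA.
Qed.

(** An ultrafilter on this set that does not converge to [x] avoids some neighborhood of [x], hence
    lives on the finitely many terms outside it, and finite sets are compact. *)
Lemma compact_cvg_range (T : topologicalType) (u : nat -> T) (x : T) :
  u @ \oo --> x -> compact (x |` range u).
Proof.
move=> ux; rewrite compact_ultra => F FU Fxu.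
have [Fx|] := pselect (F --> x); first by exists x; split => //; left.
move=> /existsNP[V /not_implyP[xV nFV]].
have [//|FV] := in_ultra_setVsetC V FU.
have [N _ NV] := ux _ xV.
have fin : finite_set (u @` `I_N) by exact/finite_image/finite_II.
have := finite_compact fin; rewrite compact_ultra => /(_ F FU).
case=> [|y [[n _ <-] Fy]]; last by exists (u n); split => //; right; exists n.
apply: filterS (filterI Fxu FV) => z [[->|[n _ <-]] nVz].
  by case: nVz; exact: nbhs_singleton.
exists n => //=; rewrite ltnNge; apply/negP => Nn; apply: nVz; exact: NV.
Qed.

(** Open sets of the initial topology are preimages under [i], so cluster points found in the
    ambient space descend to a subspace. *)
Lemma cluster_initial (S : choiceType) (T : topologicalType) (i : S -> T)
    (F : set_system (initial_topology i)) (s : initial_topology i) :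
  Filter F -> cluster (i @ F) (i s) -> cluster F s.
Proof.
move=> FF is_ A B FA [_ [[V oV <-] Vs VB]].
have [] := is_ (i @` A) V _ (open_nbhs_nbhs (conj oV Vs)).
  by apply: (@filterS _ F _ A) => // a Aa; exists a.
by move=> _ [[a Aa <-] Va]; exists a; split => //; exact: VB.
Qed.

(** * Subspaces and their inclusions *)

Section subtype.
Context (T : topologicalType) (A : set T).

Lemma set_val_continuous : continuous (set_val : A -> T).
Proof. exact: initial_continuous. Qed.

Lemma set_val_ex (x : T) : A x -> exists a : A, set_val a = x.
Proof. by move=> Ax; exists (SigSub (mem_set Ax)). Qed.

Lemma set_val_in (a : A) : A (set_val a).
Proof. exact: set_valP. Qed.

Lemma set_val_inj : injective (set_val : A -> T).
Proof. exact: val_inj. Qed.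

Lemma set_val_cluster (F : set_system A) (a : A) :
  Filter F -> cluster (set_val @ F) (set_val a) -> cluster F a.
Proof. exact: cluster_initial. Qed.

Lemma open_set_val_image (U : set A) : open A -> open U -> open (set_val @` U).
Proof.
move=> oA [V oV <-]; suff -> : set_val @` (set_val @^-1` V : set A) = V `&` A.
  exact: openI.
apply/seteqP; split=> [_ [a Va <-]|x [Vx /set_val_ex[a ax]]].
  by split => //; exact: set_val_in.
by exists a => //=; rewrite ax.
Qed.

Lemma compact_set_val_preimage (C : set T) :
  compact C -> C `<=` A -> compact (set_val @^-1` C : set A).
Proof.
move=> cC CA F FF FC; have [x [Cx Fx]] := cC (set_val @ F) _ FC.
have [a ax] := set_val_ex (CA _ Cx); exists a; rewrite /= ax; split => //.
by apply: set_val_cluster; rewrite ax.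
Qed.

End subtype.

(** * Sequences and compactness in metrizable spaces *)

Section metrizable.
Context (R : realType) (T : topologicalType) (mT : metrizable R T).
Local Open Scope ring_scope.

Lemma metrizable_hausdorff : hausdorff_space T.
Proof.
case: mT => d [d_ge0 d_eq0 dC dD dE] p q pq; apply/d_eq0/eqP.
rewrite eq_le d_ge0 andbT leNgt; apply/negP => d_gt0.
have e0 : 0 < d p q / 2 by rewrite divr_gt0.
have [] := pq [set y | d p y < d p q / 2] [set y | d q y < d p q / 2].
- by apply/dE; exists (d p q / 2).
- by apply/dE; exists (d p q / 2).
move=> z [/= pz qz]; have := dD p z q; rewrite (dC z q); lra.
Qed.

Lemma metrizable_closure_seq (A : set T) (x : T) : closure A x ->
  exists2 u : nat -> T, (forall n, A (u n)) & u @ \oo --> x.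
Proof.
case: mT => d [d_ge0 d_eq0 dC dD dE] Ax.
have /choice[u uP] (n : nat) : exists y, A y /\ d x y < n.+1%:R^-1.
  have [|y [Ay xy]] := Ax [set y | d x y < n.+1%:R^-1]; last by exists y.
  by apply/dE; exists n.+1%:R^-1; rewrite ?invr_gt0.
exists u => [n|V /dE[e e0 eV]]; first by case: (uP n).
have [N] := ltr_add_invr e0; rewrite add0r => Ne.
exists N => // n /= Nn; apply: eV; apply: lt_trans (uP n).2 _.
by apply: le_lt_trans Ne; rewrite lef_pV2 ?posrE// ler_nat.
Qed.

(** An ultrafilter containing [closure A] contains arbitrarily small balls; points of [A] close to
    their centers form a sequence, and a cluster point of it is the limit of the ultrafilter. *)
Lemma metrizable_compact_closure (A : set T) :
  (forall u : nat -> T, (forall n, A (u n)) ->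
     exists y, cluster (u @ \oo) y) ->
  compact (closure A).
Proof.
case: mT => d [d_ge0 d_eq0 dC dD dE] Aseq.
rewrite compact_ultra => F FU FA.
have ballE x e : 0 < e -> nbhs x [set y | d x y < e].
  by move=> e0; apply/dE; exists e.
(* Otherwise [A] contains an infinite (e / 2)-separated sequence. *)
have small e : 0 < e -> exists z, F [set y | d z y < e].
  move=> e0; apply: contrapT => /forallNP nF.
  have /choice[h hP] (s : seq T) :
      exists a, A a /\ forall b, b \in s -> e / 2 <= d b a.
    (* An ultrafilter without balls of radius [e] contains their complements. A point [z] of
       [closure A] far from all of [s] is then moved into [A] by less than [e / 2]. *)
    have Fs : F [set z | forall b, b \in s -> e <= d b z].
      elim: s => [|c s IH]; first exact: filterE.
      have [/nF//|Fc] := in_ultra_setVsetC [set y | d c y < e] FU.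
      apply: filterS (filterI Fc IH) => z [/= /negP + zs] b.
      by rewrite -leNgt inE => cz /predU1P[->//|/zs].
    have [z [Az zs]] := filter_ex (filterI FA Fs).
    have [a [Aa za]] := Az _ (ballE z (e / 2) (divr_gt0 e0 (ltr0Sn _ _))).
    exists a; split=> // b /zs bz; have := dD b a z; rewrite (dC a z).
    move: za; rewrite /=; lra.
  (* [S n] lists the terms of [u] of index below [n]. Two terms within [e / 4] of a common point
     contradict their separation. *)
  pose S n := iter n (fun s => h s :: s) [::].
  pose u n := h (S n).
  have uS m n : (m < n)%N -> u m \in S n.
    elim: n => // n IH; rewrite ltnS leq_eqVlt /= inE => /predU1P[->|/IH->].
      by rewrite eqxx.
    by rewrite orbT.
  have [|y /cluster_seqP uy] := Aseq u; first by move=> n; case: (hP (S n)).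
  have e4 : 0 < e / 4 by rewrite divr_gt0.
  have [m _ ym] := uy _ 0%N (ballE y _ e4).
  have [n mn yn] := uy _ m.+1 (ballE y _ e4).
  have := (hP (S n)).2 _ (uS _ _ mn); have := dD (u m) y (u n).
  rewrite (dC (u m) y) -/(u n); move: ym yn; rewrite /=; lra.
have /choice[z zP] (n : nat) : exists z, F [set y | d z y < n.+1%:R^-1].
  by apply: small; rewrite invr_gt0.
have /choice[a aP] (n : nat) : exists a, A a /\ d (z n) a < n.+1%:R^-1.
  have [x [Ax zx]] := filter_ex (filterI FA (zP n)).
  have e0 : 0 < n.+1%:R^-1 - d (z n) x by rewrite subr_gt0.
  have [b [Ab xb]] := Ax _ (ballE x _ e0).
  by exists b; split=> //; apply: le_lt_trans (dD _ x _) _; rewrite -ltrBrDl.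
have [|y /cluster_seqP ay] := Aseq a; first by move=> n; case: (aP n).
(* Each of the steps from [y] to [a n], to [z n], to [w] is shorter than [e / 4]. *)
have Fy : F --> y.
  move=> V /dE[e e0 eV].
  have e4 : 0 < e / 4 by rewrite divr_gt0.
  have [N] := ltr_add_invr e4; rewrite add0r => Ne.
  have [n Nn yn] := ay _ N (ballE y _ e4).
  have ne : n.+1%:R^-1 < e / 4.
    by apply: le_lt_trans Ne; rewrite lef_pV2 ?posrE// ler_nat.
  apply: filterS (zP n) => w /= zw; apply: eV => /=.
  have := lt_trans zw ne; have := lt_trans (aP n).2 ne.
  have := dD y (a n) w; have := dD (a n) (z n) w.
  rewrite (dC (a n) (z n)); move: yn; rewrite /=; lra.
exists y; split => //; apply: closed_closure => B yB.
exact: filter_ex (filterI FA (Fy _ yB)).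
Qed.

End metrizable.

(** * The implications between the three conditions *)

Section conditions.
Context (R : realType) (M N : topologicalType) (X : set M) (Y : set N).
Context (mM : metrizable R M) (mN : metrizable R N).
Context (clX : closed X).
Context (f : ~` X -> ~` Y) (cf : continuous f).

Lemma not_nbhs_seq (x : M) (W : set M) : X `<=` W -> ~ nbhs x W ->
  exists2 u : nat -> ~` X, (forall n, ~ W (set_val (u n))) &
    (fun n => set_val (u n)) @ \oo --> x.
Proof.
move=> XW nW; have [|v vW vx] := @metrizable_closure_seq _ _ mM (~` W) x.
  move=> B xB; apply: contrapT => WB; apply: nW; apply: filterS xB => z Bz.
  by apply: contrapT => Wz; apply: WB; exists z.
have /choice[u uv] (n : nat) : exists a : ~` X, set_val a = v n.
  by apply: set_val_ex => /XW; exact: vW.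
exists u => [n|]; first by rewrite uv; exact: vW.
by under eq_fun do rewrite uv.
Qed.

(** Away from [X], continuity of [f] already gives openness, since the complement of [X] is open;
    only points of [X] need checking. *)
Lemma pulls_back_open_nbhsP :
  pulls_back_open_nbhs f <->
  forall (U : set (~` Y)) (x : M), open (set_val @` U `|` Y) -> X x ->
    nbhs x (set_val @` (f @^-1` U) `|` X).
Proof.
split=> [pf U x oU Xx|pf U oU].
  by apply: open_nbhs_nbhs; split; [exact: pf|right].
rewrite openE => x [xU|]; last exact: pf.
apply: filterS (@subsetUl _ _ _) _; apply: open_nbhs_nbhs; split => //.
apply: open_set_val_image; first exact: closed_openC.
move/continuousP : cf; apply; have -> : U = set_val @^-1` (set_val @` U `|` Y).
  apply/seteqP; split=> [z Uz|z [[z' Uz' /set_val_inj <-]//|Yz]].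
    by left; exists z.
  by case: (set_val_in z).
by exists (set_val @` U `|` Y).
Qed.

Lemma approaching_pulls_back : approaching f -> pulls_back_open_nbhs f.
Proof.
move=> af; apply/pulls_back_open_nbhsP => U x oU Xx; apply: contrapT.
move=> /not_nbhs_seq[|u uU ux]; first exact: subsetUr.
have [|y Yy /cluster_seqP uy] := af u.
  exists x => //; apply/cluster_seqP => V k /ux[m _ mV].
  by exists (maxn k m); rewrite ?leq_maxl//; apply: mV; exact: leq_maxr.
have [|n _ [[z Uz /set_val_inj zE]|]] := uy _ 0%N (open_nbhs_nbhs (conj oU _)).
- by right.
- by apply: (uU n); left; exists (u n) => //=; rewrite -zE.
- exact: (set_val_in (f (u n))).
Qed.

Lemma pulls_back_approaching : pulls_back_open_nbhs f -> approaching f.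
Proof.
move=> pf u [x Xx /cluster_seqP ux]; apply: contrapT => nY.
set v := fun n => set_val (f (u n)) in nY *.
(* Finitely many terms form a closed set missing [y], so a point [y] of [Y] in the closure is
   approached by terms of arbitrarily large index and is a cluster point. *)
have vY y : Y y -> ~ closure (range v) y.
  move=> Yy vy; apply: nY; exists y => //; apply/cluster_seqP => V k yV.
  have clv : closed (v @` `I_k).
    apply: compact_closed (metrizable_hausdorff mN) _.
    exact/finite_compact/finite_image/finite_II.
  have [|_ [[n _ <-] [Vn vn]]] := vy (V `&` ~` (v @` `I_k)).
    apply: filterI => //; apply: open_nbhs_nbhs; split.
      exact: closed_openC.
    by move=> [n _ vny]; apply: (set_val_in (f (u n))); rewrite -/(v n) vny.
  by exists n => //; rewrite leqNgt; apply/negP => nk; apply: vn; exists n.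
pose U : set (~` Y) := set_val @^-1` (~` closure (range v)).
have UE : set_val @` U `|` Y = ~` closure (range v).
  apply/seteqP; split=> [y [[z Uz <-]//|/vY//]|y vy].
  have [Yy|nYy] := pselect (Y y); first by right.
  have [z zy] := @set_val_ex _ (~` Y) _ nYy; left; exists z => //.
  by rewrite /U /= zy.
have /pf oU : open (set_val @` U `|` Y).
  by rewrite UE; exact/closed_openC/closed_closure.
have [|n _ [[z Uz /set_val_inj zE]|]] := ux _ 0%N (open_nbhs_nbhs (conj oU _)).
- by right.
- apply: Uz; rewrite zE; apply: subset_closure; exists n => //.
- exact: (set_val_in (u n)).
Qed.

(** A sequence in the image lifts to [K] and clusters at some [x] there: if [x] is in [X],
    [approaching] applies, otherwise continuity does. *)
Lemma approaching_compact_closure (K : set (~` X)) : approaching f ->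
  compact (closure (set_val @` K)) -> compact (closure (set_val @` (f @` K))).
Proof.
move=> af cK; apply: (metrizable_compact_closure mN) => v vK.
have /choice[u uP] (n : nat) : exists a, K a /\ set_val (f a) = v n.
  by have [_ [a Ka <-] <-] := vK n; exists a.
have -> : v = fun n => set_val (f (u n)).
  by apply/funext => n; case: (uP n).
have [|x [_ ux]] := cK ((fun n => set_val (u n)) @ \oo) _.
  exists 0%N => // n _; apply: subset_closure; exists (u n) => //.
  by case: (uP n).
have [Xx|] := pselect (X x).
  by have [|y] := af u; [exists x|exists y].
move=> /(@set_val_ex _ (~` X))[a ax]; exists (set_val (f a)).
have ua : cluster (u @ \oo) a by apply: set_val_cluster; rewrite ax.
apply/cluster_seqP => V k aV.
have faV : nbhs a (f @^-1` (set_val @^-1` V)).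
  exact: (cf (set_val_continuous aV)).
by have [n kn Vn] := (cluster_seqP _ _).1 ua _ k faV; exists n.
Qed.

Lemma pulls_back_proper (K : set (~` X)) : pulls_back_open_nbhs f ->
  compact (closure (set_val @` K)) -> closed K ->
  proper_map (fun x : K => f (set_val x)).
Proof.
move=> pf cK clK.
have cg : continuous (fun x : K => f (set_val x)).
  move=> x; apply: (@continuous_comp _ _ _ set_val f); last exact: cf.
  exact: set_val_continuous.
split=> // C cC F FF FC.
have clC : closed (set_val @` C).
  apply: compact_closed (metrizable_hausdorff mN) _.
  apply: continuous_compact cC; apply: continuous_subspaceT.
  exact: set_val_continuous.
pose i (k : K) : M := set_val (set_val k).
have [|x [Kx Fx]] := cK (i @ F) _.
  apply: (@filterE _ F) => k; apply: subset_closure; exists (set_val k) => //.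
  exact: set_val_in.
(* A cluster point in [X] is impossible: the complement of [C] pulls back to a neighborhood of it
   that misses the preimage of [C], a member of [F]. *)
have [Xx|] := pselect (X x).
  have : open (set_val @` (~` C) `|` Y).
    have -> : set_val @` (~` C) `|` Y = ~` (set_val @` C).
      apply/seteqP; split=>
        [y [[z Cz <-] [z' Cz' /set_val_inj zz']|Yy [z _ zy]]|y Cy].
      - by apply: Cz; rewrite -zz'.
      - by apply: (set_val_in z); rewrite zy.
      - have [Yy|nYy] := pselect (Y y); first by right.
        have [z zy] := @set_val_ex _ (~` Y) _ nYy; left; exists z => // Cz.
        by apply: Cy; exists z.
    exact: closed_openC.
  move=> /pf oC; exfalso.
  have [||_ [[k Ck <-]]] := Fx (i @` ((fun k : K => f (set_val k)) @^-1` C)) _ _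
    (open_nbhs_nbhs (conj oC _)).
  - by apply: (@filterS _ F _ _ _ _ FC) => k Ck; exists k.
  - by right.
  - case=> [[z Cz /set_val_inj zE]|]; first by apply: Cz; rewrite zE.
    exact: (set_val_in (set_val k)).
move=> /(@set_val_ex _ (~` X))[a ax].
(* Closedness of [K] in the complement of [X] keeps the cluster point in [K]. *)
have /set_val_ex[k ka] : K a.
  apply: clK => B [_ [[V oV <-] Va VB]].
  have [|_ [[b Kb <-] Vb]] := Kx V.
    by apply: open_nbhs_nbhs; split => //; rewrite -ax.
  by exists b; split => //; exact: VB.
have Fk : cluster F k.
  apply: set_val_cluster; apply: set_val_cluster.
  by rewrite ka ax.
exists k; split => //=.
have clgC : closed ((fun k : K => f (set_val k)) @^-1` C).
  apply: preimage_closed => //.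
  have -> : C = set_val @^-1` (set_val @` C).
    by apply/seteqP; split=> [z Cz|z [z' Cz' /set_val_inj <-//]]; exists z.
  by apply: preimage_closed => // z _; exact: set_val_continuous.
by apply: clgC => B kB; exact: Fk.
Qed.

Lemma proper_pulls_back : restrictions_proper f -> pulls_back_open_nbhs f.
Proof.
move=> rf; apply/pulls_back_open_nbhsP => U x oU Xx; apply: contrapT.
move=> /not_nbhs_seq[|u uU ux]; first exact: subsetUr.
pose K := range u.
have KE : set_val @` K = range (fun n => set_val (u n)).
  by rewrite /K image_comp.
have cS := compact_cvg_range ux; rewrite -KE in cS.
have clS := compact_closed (metrizable_hausdorff mM) cS.
have cK : compact (closure (set_val @` K)).
  apply: subclosed_compact (@closed_closure _ _) cS _.
  by rewrite [X in _ `<=` X]((closure_id _).1 clS); exact/closureS/subsetUr.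
(* Since [x] lies in [X], adding it to the range does not change the trace on the complement of
   [X]. *)
have clK : closed K.
  have -> : K = set_val @^-1` (x |` set_val @` K).
    apply/seteqP; split=> [a Ka|a [ax|[b Kb /set_val_inj <-//]]].
      by right; exists a.
    by case: (set_val_in a); rewrite ax.
  by apply: preimage_closed => // z _; exact: set_val_continuous.
have [cD /(_ clK)[_ pg]] := rf K cK.
pose E := closure (set_val @` (f @` K)) `&` ~` (set_val @` U `|` Y).
have cE : compact E by apply: compact_closedI => //; exact: open_closedC.
have EY : E `<=` ~` Y by move=> y [_ UYy] Yy; apply: UYy; right.
have := pg _ (compact_set_val_preimage cE EY).
set G := _ @^-1` _ => cG.
have : compact ((fun k : K => set_val (set_val k)) @` G).
  apply: continuous_compact cG; apply: continuous_subspaceT => k.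
  apply: (@continuous_comp _ _ _ set_val set_val); exact: set_val_continuous.
(* Every [f (u n)] avoids [U], hence lies in [E], so [G] is all of [K]. *)
have -> : (fun k : K => set_val (set_val k)) @` G = set_val @` K.
  apply/seteqP; split=> [_ [k Gk <-]|_ [_ [n _ <-] <-]].
    by exists (set_val k) => //; exact: set_val_in.
  have [k ku] : exists k : K, set_val k = u n by apply: set_val_ex; exists n.
  exists k; last by rewrite ku.
  rewrite /G /E /= ku; split.
    apply: subset_closure; exists (f (u n)) => //.
    by exists (u n) => //; exists n.
  case=> [[z Uz /set_val_inj zE]|]; last exact: (set_val_in (f (u n))).
  by apply: (uU n); left; exists (u n) => //=; rewrite -zE.
(* The image of [K] in [M] would be closed and so contain the limit [x], a point of [X]. *)
move=> /(compact_closed (metrizable_hausdorff mM)) /(_ x) [].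
  move=> B /ux [k _ kB]; exists (set_val (u k)); split; last by apply: kB => /=.
  by exists (u k) => //; exists k.
by move=> a _ ax; apply: (set_val_in a); rewrite ax.
Qed.

End conditions.

Theorem theorem1 (R : realType) (M N : topologicalType)
    (X : set M) (Y : set N)
    (arM : absolute_retract R M) (arN : absolute_retract R N)
    (ZX : Zset R X) (ZY : Zset R Y)
    (f : ~` X -> ~` Y) (cf : continuous f) :
  (approaching f <-> pulls_back_open_nbhs f) /\
  (pulls_back_open_nbhs f <-> restrictions_proper f).
Proof.
have [mM _] := arM; have [mN _] := arN; have [clX _] := ZX.
have p2a : pulls_back_open_nbhs f -> approaching f.
  exact: (pulls_back_approaching mN).
split; first by split=> //; exact: (approaching_pulls_back mM clX cf).
split=> [pf K cK|]; last exact: (proper_pulls_back mM clX cf).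
split; first exact: (approaching_compact_closure mN cf (p2a pf)).
by move=> clK; exact: (pulls_back_proper mN).
Qed.
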